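(* Let $\varphi$ be a skew morphism of a finite abelian group $B$, let $K=\ker\varphi$, and let $q$ be any prime divisor of $|K|$. Let $N$ be the subgroup of $K$ consisting of the identity and all elements of order $q$, and let $L$ be the subgroup of $B$ containing $N$ such that $L/N$ is the kernel of the skew morphism $\varphi_N^*$ of $B/N$ induced by $\varphi$. If $p$ is a prime that divides $|L|$ but not $|K|$, then $p<q$.
   Context: For a finite group $B$, a skew morphism of $B$ is a permutation $\varphi$ of $B$ fixing the identity such that for every $a\in B$ there is a positive integer $i_a$ with $\varphi(ab)=\varphi(a)\varphi^{i_a}(b)$ for all $b\in B$. Its order $\mathrm{ord}(\varphi)$ is the order of $\langle\varphi\rangle$. The power function $\pi$ maps $a$ to the unique such $i_a\in\{1,\dots,\mathrm{ord}(\varphi)\}$ (with $\pi\equiv 1$ for the identity), and the kernel is $\ker\varphi=\{a\in B:\pi(a)=1\}$, a subgroup of $B$. For $B$ abelian, $\varphi$ restricts to an automorphism of $\ker\varphi$, so it preserves $N$; the induced skew morphism $\varphi_N^*$ of $B/N$ is the well-defined skew morphism $Nx\mapsto N\varphi(x)$, and its kernel is a subgroup of $B/N$, hence of the form $L/N$ with $N\le L\le B$. *)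

(* Defs.v *)
From mathcomp Require Import all_boot all_fingroup all_solvable.

Set Implicit Arguments.
Unset Strict Implicit.
Unset Printing Implicit Defensive.

Local Open Scope group_scope.

Section SkewMorphism.

Variable gT : finGroupType.
Implicit Types (phi : {perm gT}) (a b : gT).

Definition is_skew_morphism phi : Prop :=
  phi 1 = 1 /\
  forall a, exists i : nat,
    (0 < i)%N /\ forall b, phi (a * b) = phi a * (phi ^+ i) b.

(* #[phi] is the order of <[phi]> in {perm gT}. The index i : 'I_#[phi] stands
   for the exponent i.+1 in {1, ..., #[phi]}. The value 0 is never taken when
   phi is a skew morphism, and the exponent is unique (skew_powP). *)
Definition skew_pow phi a : nat :=
  if [pick i : 'I_#[phi] | [forall b, phi (a * b) == phi a * (phi ^+ i.+1) b]]
    is Some i then i.+1 else 0.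

Definition skew_ker phi : {set gT} := [set a | skew_pow phi a == 1%N].

(* The permutation N x |-> N (phi x) of the type coset_of N, which is gT / N
   when N is normal in gT. The default value 1 is not reached when gT is abelian
   and N is a subgroup of the kernel preserved by phi (induced_permE). *)
Definition induced_perm phi (N : {set gT}) : {perm coset_of N} :=
  odflt 1 [pick psi : {perm coset_of N} |
             [forall x, psi (coset N x) == coset N (phi x)]].

Lemma skew_powP phi a : is_skew_morphism phi ->
  [/\ (0 < skew_pow phi a <= #[phi])%N,
      forall b, phi (a * b) = phi a * (phi ^+ skew_pow phi a) b
    & forall i, (0 < i <= #[phi])%N ->
        (forall b, phi (a * b) = phi a * (phi ^+ i) b) -> i = skew_pow phi a].
Proof.
case=> _ /(_ a) [i [i_gt0 Hi]].
have powP : (0 < skew_pow phi a <= #[phi])%N /\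
    forall b, phi (a * b) = phi a * (phi ^+ skew_pow phi a) b.
  rewrite /skew_pow; case: pickP => [j /forallP Hj | none].
    by split=> [|b]; [rewrite /= ltn_ord | exact/eqP].
  have lt_j : (i.-1 %% #[phi] < #[phi])%N by rewrite ltn_mod order_gt0.
  case/negP: (none (Ordinal lt_j)); apply/forallP => b /=.
  by rewrite Hi expgS expg_mod_order -expgS prednK.
case: powP => /[dup] le_pow /andP[pow_gt0 pow_le] Hpow; split=> // j /andP[j0 jl] Hj.
have eq_ij : phi ^+ j = phi ^+ skew_pow phi a.
  by apply/permP => b; apply: (mulgI (phi a)); rewrite -Hj Hpow.
move: eq_ij; rewrite -(prednK j0) -(prednK pow_gt0) !expgS => /mulgI /eqP.
rewrite eq_expg_mod_order !modn_small ?prednK // => /eqP eq_ij.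
by rewrite -(prednK j0) -(prednK pow_gt0) eq_ij.
Qed.

Lemma skew_kerP phi a : is_skew_morphism phi ->
  reflect (forall b, phi (a * b) = phi a * phi b) (a \in skew_ker phi).
Proof.
move=> skew; have [_ Hpow uniq] := skew_powP a skew.
rewrite inE; apply: (iffP eqP) => [pow1 b | Ha].
  by rewrite Hpow pow1 expg1.
by symmetry; apply: uniq => [|b]; rewrite ?order_gt0 // expg1.
Qed.

Lemma group_set_skew_ker phi : is_skew_morphism phi -> group_set (skew_ker phi).
Proof.
move=> skew; apply/group_setP; split=> [|a b /(skew_kerP _ skew) Ha].
  by apply/(skew_kerP _ skew) => b; rewrite skew.1 !mul1g.
move=> /(skew_kerP _ skew) Hb; apply/(skew_kerP _ skew) => c.
by rewrite -mulgA !Ha Hb mulgA.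
Qed.

End SkewMorphism.

Section Abelian.

Variable gT : finGroupType.
Implicit Types (phi : {perm gT}) (a b : gT).
Hypothesis abT : abelian [set: gT].

Let mulC a b : a * b = b * a.
Proof. exact: (centsP abT) (in_setT a) _ (in_setT b). Qed.

Lemma skew_ker_stable phi a : is_skew_morphism phi ->
  a \in skew_ker phi -> phi a \in skew_ker phi.
Proof.
move=> skew /(skew_kerP _ skew) Ha; apply/(skew_kerP _ skew) => b.
have [_ Hb _] := skew_powP b skew.
have com : (phi ^+ skew_pow phi b) a = phi a.
  by apply: (mulgI (phi b)); rewrite -Hb [b * a]mulC Ha [RHS]mulC.
by rewrite [phi a * b]mulC Hb -permM -expgS expgSr permM com mulC.
Qed.

Lemma group_set_ker_order phi q : is_skew_morphism phi -> prime q ->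
  group_set [set x in skew_ker phi | (x == 1) || (#[x] == q)].
Proof.
move=> skew pr_q; have /group_setP[K1 KM] := group_set_skew_ker skew.
have ordE (x : gT) : (x == 1) || (#[x] == q) = (x ^+ q == 1).
  rewrite -order_dvdn -order_eq1; apply/orP/idP => [[]/eqP->//|].
  by case/primeP: pr_q => _ H /H/orP.
apply/group_setP; split=> [|x y]; rewrite !inE ?eqxx /= ?andbT.
  by move: K1; rewrite inE.
rewrite !ordE => /andP[Kx /eqP xq] /andP[Ky /eqP yq].
rewrite expgMn; last exact: mulC.
by rewrite xq yq mulg1 eqxx andbT; move: (KM x y); rewrite !inE; apply.
Qed.

Lemma ker_order_stable phi q : is_skew_morphism phi ->
  let N := [set x in skew_ker phi | (x == 1) || (#[x] == q)] in
  forall x, x \in N -> phi x \in N.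
Proof.
move=> skew N x.
have inN y : (y \in N) = (y \in skew_ker phi) && ((y == 1) || (#[y] == q)).
  by rewrite in_set.
rewrite !inN => /andP[Kx ordx].
rewrite (skew_ker_stable skew Kx) /=.
have phiX n : phi (x ^+ n) = phi x ^+ n.
  elim: n => [|n IHn]; first by rewrite !expg0 skew.1.
  by rewrite !expgS -IHn; apply/(skew_kerP _ skew).
case/orP: ordx => [/eqP-> | /eqP<-]; first by rewrite skew.1 eqxx.
apply/orP; right; rewrite eqn_dvd !order_dvdn -phiX expg_order skew.1 eqxx /=.
by rewrite -(inj_eq (@perm_inj _ phi)) phiX expg_order skew.1.
Qed.

Section Induced.

Variables (phi : {perm gT}) (N : {group gT}).
Hypothesis skew : is_skew_morphism phi.
Hypothesis sNK : N \subset skew_ker phi.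
Hypothesis stabN : forall x, x \in N -> phi x \in N.

Let normN x : x \in 'N(N).
Proof. by rewrite (subsetP (sub_abelian_norm abT (subsetT N))) ?in_setT. Qed.

Lemma induced_permE x : induced_perm phi N (coset N x) = coset N (phi x).
Proof.
pose f (X : coset_of N) := coset N (phi (repr X)).
pose g (X : coset_of N) := coset N (phi^-1 (repr X)).
have fE y : f (coset N y) = coset N (phi y).
  rewrite /f; have [n Nn ->] : exists2 n, n \in N & repr (coset N y) = n * y.
    by apply: kercoset_rcoset; rewrite ?coset_reprK.
  rewrite (skew_kerP _ skew (subsetP sNK _ Nn)).
  by rewrite coset_kerl ?stabN.
have gK : cancel g f by move=> X; rewrite fE permKV coset_reprK.
have fI : injective f := can_inj (canF_sym gK).
rewrite /induced_perm; case: pickP => [psi /forallP/(_ x)/eqP // | none].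
case/negP: (none (perm fI)); apply/forallP => y.
by rewrite permE fE.
Qed.

Lemma induced_perm_skew : is_skew_morphism (induced_perm phi N).
Proof.
have powE i x : (induced_perm phi N ^+ i) (coset N x) = coset N ((phi ^+ i) x).
  elim: i x => [|i IHi] x; first by rewrite !expg0 !perm1.
  by rewrite !expgS !permM induced_permE IHi.
split=> [|X]; first by rewrite -(coset_id (group1 N)) induced_permE skew.1.
have [i [i_gt0 Hi]] := skew.2 (repr X).
exists i; split=> // Y; rewrite -(coset_reprK X) -(coset_reprK Y).
by rewrite -morphM ?normN // !induced_permE powE Hi morphM ?normN.
Qed.

Lemma ex_induced_ker : exists L : {group gT},
  N \subset L /\ L / N = skew_ker (induced_perm phi N).
Proof.
exists (coset N @*^-1 Group (group_set_skew_ker induced_perm_skew))%G.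
by split; [exact: sub_cosetpre | exact: cosetpreK].
Qed.

End Induced.

End Abelian.

(* Main.v *)
(** Let [K] be the kernel of [phi]. For [x] in [L] with power [i], the
    permutation [psi = phi ^+ i.-1] preserves every coset of [N], since [x] lies
    in the kernel modulo [N], and it commutes with the translations by [N], since
    [B] is abelian and [N] is a [phi]-stable subgroup of [K]. Hence [psi] is
    [y |-> n(y) y] with [n(y)] in [N] constant on the orbits of [psi], so
    [psi ^+ q = 1]. The cyclic group [<[phi]>] has at most [q] such elements, and
    [psi] determines the coset [K x], so [#|L : K| <= q]. Now [p] divides this
    index, and [p] differs from [q]. *)
Require Import Defs.
From mathcomp Require Import all_boot all_fingroup all_solvable.

Local Open Scope group_scope.

(** The solutions of [h ^+ q = 1] in [<[g]>] form a subgroup, again cyclic, and the order of its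
    generator divides [q]. *)
Lemma leq_card_cyclic_exponent (gT : finGroupType) (g : gT) (q : nat)
    (A : {set gT}) :
  (0 < q)%N -> A \subset <[g]> -> {in A, forall h, h ^+ q = 1} ->
  (#|A| <= q)%N.
Proof.
move=> q_gt0 sAg Aq.
have gH : group_set [set h in <[g]> | h ^+ q == 1].
  apply/group_setP; split=> [|x y]; rewrite !inE.
    by rewrite group1 expg1n /=.
  case/andP=> gx /eqP xq /andP[gy /eqP yq]; rewrite groupM //=.
  have cxy : commute x y by apply: (centsP (cycle_abelian g)).
  by rewrite expgMn // xq yq mulg1.
pose H := Group gH.
have sHg : H \subset <[g]> by apply/subsetP => h; rewrite inE => /andP[].
have /cyclicP[h defH] : cyclic H := cyclicS sHg (cycle_cyclic g).
have : h \in H by rewrite defH cycle_id.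
rewrite inE => /andP[_ hq].
apply: leq_trans (_ : #|H| <= q)%N; last first.
  by rewrite defH dvdn_leq // order_dvdn.
apply/subset_leq_card/subsetP => a Aa.
by rewrite inE (subsetP sAg) //= Aq.
Qed.

Section SkewMorphism.

Variables (gT : finGroupType) (phi : {perm gT}).
Hypothesis skew : is_skew_morphism phi.

Lemma eq_skew_pow_ker (x y : gT) :
  phi ^+ skew_pow phi x = phi ^+ skew_pow phi y -> x * y^-1 \in skew_ker phi.
Proof.
move=> eq_pow; have [_ Hx _] := skew_powP x skew.
have [_ Hy _] := skew_powP y skew.
(* Write [b] as [y * (y^-1 * b)]: the common power cancels. Taking [b = 1] below identifies the
   constant factor as [phi (x * y^-1)]. *)
have phiM b : phi (x * y^-1 * b) = phi x * (phi y)^-1 * phi b.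
  by rewrite -mulgA Hx eq_pow -[in phi b](mulKVg y b) Hy !mulgA mulgKV.
apply/(skew_kerP _ skew) => b.
by rewrite phiM -[x * y^-1]mulg1 phiM skew.1 mulg1.
Qed.

Hypothesis abT : abelian [set: gT].

(** Expand [phi (x * n) = phi (n * x)] from both sides and cancel [phi x]; injectivity of [phi] then
    lowers the exponent by one. *)
Lemma skew_pow_ker_fix (x n : gT) :
  n \in skew_ker phi -> (phi ^+ (skew_pow phi x).-1) n = n.
Proof.
move=> Kn; have [/andP[pow_gt0 _] Hx _] := skew_powP x skew.
have mulC (a b : gT) : a * b = b * a by apply: (centsP abT); rewrite in_setT.
apply: (@perm_inj _ phi); rewrite -permM -expgSr prednK //.
apply: (mulgI (phi x)).
by rewrite -Hx mulC (skew_kerP _ skew Kn) mulC.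
Qed.

Lemma skew_expM (i : nat) (n y : gT) :
  n \in skew_ker phi -> (phi ^+ i) (n * y) = (phi ^+ i) n * (phi ^+ i) y.
Proof.
elim: i n y => [|i IHi] n y Kn; first by rewrite !perm1.
by rewrite !expgS !permM (skew_kerP _ skew Kn) IHi // skew_ker_stable.
Qed.

Variable N : {group gT}.
Hypothesis sNK : N \subset skew_ker phi.
Hypothesis stabN : forall x, x \in N -> phi x \in N.

Let normN z : z \in 'N(N).
Proof. by rewrite (subsetP (sub_abelian_norm abT (subsetT N))) ?in_setT. Qed.

Lemma coset_skew_pow (x y : gT) :
  coset N x \in skew_ker (induced_perm phi N) ->
  coset N ((phi ^+ (skew_pow phi x).-1) y) = coset N y.
Proof.
have [/andP[pow_gt0 _] Hx _] := skew_powP x skew.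
have indE := induced_permE abT skew sNK stabN.
move/(skew_kerP _ (induced_perm_skew abT skew sNK stabN)).
(* The argument [phi^-1 y] absorbs one factor of [phi], turning the exponent [skew_pow phi x] into
   its predecessor. *)
move/(_ (coset N (phi^-1 y))).
rewrite -morphM ?normN // !indE Hx morphM ?normN // => /mulgI.
by rewrite -[in phi ^+ _](prednK pow_gt0) expgS permM permKV.
Qed.

Lemma skew_pow_expg_exponent (q : nat) (x : gT) :
  {in N, forall n, n ^+ q = 1} ->
  coset N x \in skew_ker (induced_perm phi N) ->
  (phi ^+ (skew_pow phi x).-1) ^+ q = 1.
Proof.
move=> Nq Lx; set psi := phi ^+ _.
apply/permP => y; rewrite perm1.
have [n Nn psiy] : exists2 n, n \in N & psi y = n * y.
  have /rcosetP[n Nn ->] : psi y \in N :* y; last by exists n.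
  by apply/rcoset_kercosetP; rewrite ?normN // coset_skew_pow.
(* Since [psi] fixes [n ^+ k], each further application only contributes one more factor [n]. *)
have psiX k : (psi ^+ k) y = n ^+ k * y.
  elim: k => [|k IHk]; first by rewrite perm1 mul1g.
  have KnX : n ^+ k \in skew_ker phi by rewrite (subsetP sNK) ?groupX.
  rewrite expgSr permM IHk skew_expM // skew_pow_ker_fix // -/psi psiy.
  by rewrite mulgA -expgSr.
by rewrite psiX Nq // mul1g.
Qed.

Lemma skew_ker_index_leq (q : nat) (K L : {group gT}) :
  (0 < q)%N -> {in N, forall n, n ^+ q = 1} ->
  K = skew_ker phi :> {set gT} -> L / N = skew_ker (induced_perm phi N) ->
  (#|L : K| <= q)%N.
Proof.
move=> q_gt0 Nq defK defL.
pose F (A : {set gT}) := phi ^+ (skew_pow phi (repr A)).-1.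
(* Cosets of [L :&: K] stay inside [L], so their representatives lie in [L]. *)
rewrite -indexgI -[#|L : L :&: K|]/(#|rcosets (L :&: K) L|).
have reprP A : A \in rcosets (L :&: K) L ->
    repr A \in L /\ A = (L :&: K) :* repr A.
  case/rcosetsP=> x Lx ->; split; last by rewrite rcoset_repr.
  by case: repr_rcosetP => k /setIP[Lk _]; rewrite groupM.
have FI : {in rcosets (L :&: K) L &, injective F}.
  move=> A B /reprP[LA defA] /reprP[LB defB] eqF.
  rewrite defA defB; apply/rcoset_eqP; rewrite mem_rcoset inE.
  rewrite groupM ?groupV //= defK; apply: eq_skew_pow_ker.
  have [/andP[A_gt0 _] _ _] := skew_powP (repr A) skew.
  have [/andP[B_gt0 _] _ _] := skew_powP (repr B) skew.
  (* Both powers are positive, so multiplying by [phi] undoes the predecessors in [F]. *)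
  by rewrite -(prednK A_gt0) -(prednK B_gt0) !expgS; congr (_ * _).
rewrite -(card_in_imset FI); apply: (@leq_card_cyclic_exponent _ phi) => //.
  by apply/subsetP => _ /imsetP[A _ ->]; rewrite mem_cycle.
move=> _ /imsetP[A /reprP[LA _] ->].
by apply: skew_pow_expg_exponent; rewrite // -defL mem_quotient.
Qed.

End SkewMorphism.

Theorem theorem3p2 (gT : finGroupType) (phi : {perm gT}) (p q : nat)
  (N L : {group gT})
  (abB : abelian [set: gT])
  (skew : is_skew_morphism phi)
  (q_prime : prime q)
  (q_dvd : q %| #|skew_ker phi|)
  (defN : N = [set x in skew_ker phi | (x == 1) || (#[x] == q)] :> {set gT})
  (sNL : N \subset L)
  (defL : L / N = skew_ker (induced_perm phi N))
  (p_prime : prime p)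
  (p_dvd : p %| #|L|)
  (p_ndvd : ~~ (p %| #|skew_ker phi|)) :
  (p < q)%N.

Proof.
pose K := Group (group_set_skew_ker skew).
have inN x : (x \in N) = (x \in skew_ker phi) && ((x == 1) || (#[x] == q)).
  by rewrite -[N : {set gT}]/(gval N) defN in_set.
have sNK : N \subset skew_ker phi by apply/subsetP => x; rewrite inN => /andP[].
have stabN x : x \in N -> phi x \in N.
  by rewrite defN; exact: ker_order_stable.
have Nq : {in N, forall n, n ^+ q = 1}.
  move=> n; rewrite inN => /andP[_ /orP[/eqP-> | /eqP<-]].
    by rewrite expg1n.
  exact: expg_order.
have le_q : (#|L : K| <= q)%N.
  by apply: (skew_ker_index_leq _ _ skew abB N sNK stabN q K L) => //; exact: prime_gt0.
have p_dvd_index : p %| #|L : K|.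
  move: p_dvd; rewrite -(LagrangeI L K) Euclid_dvdM // => /orP[p_dvdI | //].
  by case/negP: p_ndvd; apply: dvdn_trans p_dvdI (cardSg (subsetIr L K)).
(* So [p <= q], and [p = q] is excluded because [q] divides the order of the kernel. *)
rewrite ltn_neqAle (leq_trans (dvdn_leq _ p_dvd_index)) // andbT.
by apply: contraNneq p_ndvd => ->.
Qed.
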